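(* Let $\alpha_1,\alpha_2,\beta_1,\beta_2\in[0,1]$ with $\alpha_1+\beta_1=\alpha_2+\beta_2=1$, and let $0<\delta\leqslant 2^{-20}$. Then the set $$\mathrm{BAD}(0,1;\delta)\cap \mathrm{BAD}^*(\alpha_1,\beta_1;\delta)\cap \mathrm{BAD}^*(\alpha_2,\beta_2;\delta)$$ is nonempty.
   Context: For real $t$, $\|t\|$ denotes the distance from $t$ to the nearest integer; $\log$ is the natural logarithm. For $\alpha,\beta\in[0,1]$ with $\alpha+\beta=1$ and $\delta>0$: $$\mathrm{BAD}(\alpha,\beta;\delta)=\Big\{(\xi_1,\xi_2)\in[0,1]^2:\ \inf_{p\in\mathbb{N}}\max\{p^\alpha\|p\xi_1\|,\ p^\beta\|p\xi_2\|\}\geqslant\delta\Big\},$$ $$\mathrm{BAD}^*(\alpha,\beta;\delta)=\Big\{(\xi_1,\xi_2)\in[0,1]^2:\ \inf_{p\in\mathbb{N}}\max\{(p\log(p+1))^\alpha\|p\xi_1\|,\ (p\log(p+1))^\beta\|p\xi_2\|\}\geqslant\delta\Big\}.$$ (Here $p^0=1$, so $\mathrm{BAD}(0,1;\delta)$ consists of pairs with $\inf_p\max\{\|p\xi_1\|,p\|p\xi_2\|\}\geqslant\delta$.) *)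

(* Defs.v *)
From Stdlib Require Import Reals.
Open Scope R_scope.

Definition dist_int (t : R) : R :=
  let f := IZR (Int_part t) in Rmin (t - f) (f + 1 - t).

Definition unit_int (x : R) : Prop := 0 <= x <= 1.

(* BAD(a,b;d): inf over p in N (p >= 1) of max{p^a ||p x1||, p^b ||p x2||} >= d.
   inf >= d  is equivalent to every term being >= d. *)
Definition BAD (a b d : R) (x1 x2 : R) : Prop :=
  unit_int x1 /\ unit_int x2 /\
  forall p : nat, (1 <= p)%nat ->
    d <= Rmax (Rpower (INR p) a * dist_int (INR p * x1))
              (Rpower (INR p) b * dist_int (INR p * x2)).

Definition BADstar (a b d : R) (x1 x2 : R) : Prop :=
  unit_int x1 /\ unit_int x2 /\
  forall p : nat, (1 <= p)%nat ->
    d <= Rmax (Rpower (INR p * ln (INR p + 1)) a * dist_int (INR p * x1))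
              (Rpower (INR p * ln (INR p + 1)) b * dist_int (INR p * x2)).

(* Main.v *)
Require Import Defs.
From Stdlib Require Import Reals ZArith Lra Lia.
From mathcomp Require Import all_boot.
Open Scope R_scope.

(** Take [x2 = sqrt 2 - 1], so that [p * ||p x2|| >= 1/4] for all [p]; this
already gives BAD(0,1).  On this fibre, [x1] must avoid, for each pair (a,b), the
rho_p/p-neighbourhoods of the fractions with denominator [p], where
[rho_p = d / (p log(p+1))^a], but only for those [p] with
[||p x2|| < d / (p log(p+1))^b].  These [p] are separated, so that there are
O(2^k d / (k 2^k)^b) of them in the block [2^k <= p < 2^(k+1)], and the block
removes a proportion O(d^2/k) of every interval of length at least [2^-k].
Following Peres and Schlag, this is compared with the set surviving at scale
[2^-k], which is coarser than the current one only by a bounded power: the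
blocks in between number O(k) and have removed only a bounded proportion of it.
Survivors are counted in the tree of base-16 subintervals of [0,1], block [k]
being removed at level [k + 6], where the intervals are short enough to resolve
all the neighbourhoods in it. *)

(** * Casts from naturals to reals, and a boolean strict order *)

Lemma INRD m n : INR (m + n)%N = INR m + INR n.
Proof. exact: plus_INR. Qed.

Lemma INRM m n : INR (m * n)%N = INR m * INR n.
Proof. exact: mult_INR. Qed.

Lemma INRX m n : INR (m ^ n)%N = INR m ^ n.
Proof. by elim: n => [|n IH] //; rewrite expnS INRM IH. Qed.

Lemma INR_pow2 n : INR (2 ^ n)%N = 2 ^ n.
Proof. by rewrite INRX. Qed.

Lemma INR_pow2S n : INR (2 ^ n.+1)%N = 2 * 2 ^ n.
Proof. by rewrite INR_pow2. Qed.

Lemma leR_nat m n : (m <= n)%N -> INR m <= INR n.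
Proof. by move/leP/le_INR. Qed.

Lemma ltR_nat m n : (m < n)%N -> INR m < INR n.
Proof. by move/ltP/lt_INR. Qed.

Lemma INR_16 : INR 16 = 16.
Proof. by rewrite /=; lra. Qed.

Lemma pow16_gt0 n : 0 < 16 ^ n.
Proof. apply: pow_lt; lra. Qed.

Definition ltR (x y : R) : bool := if Rlt_dec x y then true else false.

Lemma ltRP x y : reflect (x < y) (ltR x y).
Proof. by rewrite /ltR; case: Rlt_dec => h; constructor. Qed.

(** * Distance to the nearest integer *)

Lemma dist_int_attained t : exists a : Z, dist_int t = Rabs (t - IZR a).
Proof.
have [h1 h2] := base_Int_part t.
rewrite /dist_int /Rmin; case: Rle_dec => h.
- exists (Int_part t); rewrite Rabs_pos_eq; lra.
- exists (Int_part t + 1)%Z; rewrite plus_IZR Rabs_left1; lra.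
Qed.

Lemma dist_int_le t (a : Z) : dist_int t <= Rabs (t - IZR a).
Proof.
have [h1 h2] := base_Int_part t.
case: (Z.le_gt_cases a (Int_part t)) => h.
- apply: Rle_trans (Rmin_l _ _) _; have := IZR_le _ _ h => h'.
  rewrite Rabs_pos_eq; lra.
- apply: Rle_trans (Rmin_r _ _) _.
  have /IZR_le : (Int_part t + 1 <= a)%Z by lia.
  rewrite plus_IZR => h'; rewrite Rabs_left1; lra.
Qed.

(** * Bad approximability of the square root of 2 *)

(** The exponent of 2 is even on the left and odd on the right. *)
Lemma sqr_neq_double (m n : nat) : (0 < n)%N -> (m ^ 2)%N <> (2 * n ^ 2)%N.
Proof.
move=> n0 e; have := congr1 (logn 2) e.
rewrite lognM ?expn_gt0 ?n0 // !lognX (_ : logn 2 2 = 1%N) // => /(congr1 odd).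
by rewrite oddD !oddM.
Qed.

(** With [b = a + n], the nonzero integer [b^2 - 2 n^2] factors as [x * (x - 2 n sqrt 2)], where [x]
    is the error. When [x] is at most 1/4 in absolute value, the conjugate factor is at most [4 n],
    whence the constant 1/4. *)
Lemma sqrt2_badly_approximable (n : nat) (a : Z) : (0 < n)%N ->
  / 4 <= INR n * Rabs (INR n * (sqrt 2 - 1) - IZR a).
Proof.
move=> n0; have n1 : 1 <= INR n by apply: (leR_nat 1).
have s2 : sqrt 2 * sqrt 2 = 2 by apply: sqrt_sqrt; lra.
have s0 := sqrt_pos 2.
have s3 : sqrt 2 <= 3/2 by nra.
set x := INR n * (sqrt 2 - 1) - IZR a.
case: (Rle_lt_dec (/ 4) (Rabs x)) => h; first by nra.
set b := (a + Z.of_nat n)%Z.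
have eb : IZR b = INR n * sqrt 2 - x by rewrite /b plus_IZR -INR_IZR_INZ /x; lra.
have hb : (b * b - 2 * (Z.of_nat n * Z.of_nat n) <> 0)%Z.
  move=> e; apply: (@sqr_neq_double (Z.abs_nat b) n n0).
  apply: Nat2Z.inj; rewrite -!mulnn !Nat2Z.inj_mul Zabs2Nat.id_abs -Z.abs_mul.
  rewrite Z.abs_eq; last by exact: Z.square_nonneg.
  by move: e; rewrite /= => e; apply: Zminus_eq; rewrite -[RHS]e.
have h1 : 1 <= Rabs (IZR (b * b - 2 * (Z.of_nat n * Z.of_nat n))).
  by rewrite -abs_IZR; apply: IZR_le; lia.
move: h1; rewrite minus_IZR !mult_IZR -INR_IZR_INZ eb.
have -> : (INR n * sqrt 2 - x) * (INR n * sqrt 2 - x) - 2 * (INR n * INR n)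
   = x * (x - 2 * INR n * sqrt 2) by rewrite -{3}s2; ring.
rewrite Rabs_mult => h1.
have h2 : Rabs (x - 2 * INR n * sqrt 2) <= 4 * INR n.
  apply: Rle_trans (Rabs_triang _ _) _.
  rewrite Rabs_Ropp [X in _ + X]Rabs_pos_eq; nra.
have := Rabs_pos x; nra.
Qed.

(** * Counting denominators in a block and points in a window *)

(** The induction carries the last element [z] found so far; each new element lies at least [g]
    beyond it. *)
Lemma count_separated (T : pred nat) (g : R) a n :
  (forall x y, T x -> T y -> (x < y)%N -> g <= INR y - INR x) ->
  (count T (iota a n) = 0%N) \/
  (exists2 z, [&& T z, a <= z & z < a + n]%N &
     (INR (count T (iota a n)) - 1) * g <= INR z - INR a).
Proof.
move=> sep; elim: n => [|n IH]; first by left.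
rewrite -addn1 iotaD count_cat /= addn0.
have [Tn|Tn] := boolP (T (a + n)%N); last first.
  rewrite addn0; case: IH => [->|[z /and3P[Tz az zn] h]]; [by left|right].
  by exists z; rewrite // Tz az /= addnA addn1 ltnS ltnW.
right; exists (a + n)%N; first by rewrite Tn leq_addr addnA addn1 ltnS leqnn.
rewrite INRD /=.
case: IH => [->|[z /and3P[Tz az zn] h]].
  by rewrite INRD /=; have := pos_INR n; lra.
have := sep _ _ Tz Tn zn; rewrite INRD; nra.
Qed.

Lemma count_diam (T : pred nat) (D : R) a n : 0 <= D ->
  (forall x y, T x -> T y -> INR y - INR x <= D) ->
  INR (count T (iota a n)) <= D + 1.
Proof.
move=> D0 diam.
suff : (count T (iota a n) = 0%N) \/
  (exists2 z, [&& T z, a <= z & z < a + n]%N & exists2 y, T y &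
     INR (count T (iota a n)) - 1 <= INR z - INR y).
  case=> [->|[z /and3P[Tz _ _] [y Ty h]]]; first by rewrite /=; lra.
  have := diam _ _ Ty Tz; lra.
elim: n => [|n IH]; first by left.
rewrite -addn1 iotaD count_cat /= addn0.
have [Tn|Tn] := boolP (T (a + n)%N); last first.
  rewrite addn0; case: IH => [->|[z /and3P[Tz az zn] h]]; [by left|right].
  by exists z; rewrite // Tz az /= addnA addn1 ltnS ltnW.
right; exists (a + n)%N; first by rewrite Tn leq_addr addnA addn1 ltnS leqnn.
case: IH => [->|[z /and3P[Tz az zn] [y Ty h]]].
  by exists (a + n)%N => //=; lra.
exists y => //; rewrite INRD /=.
have := leR_nat _ _ zn; rewrite S_INR; lra.
Qed.

(** Union bound over [s]. *)
Lemma count_has (A : Type) (T : A -> pred nat) (s : seq A) (l : seq nat) (C : R) :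
  (forall a, INR (count (T a) l) <= C) ->
  INR (count (fun i => has (T^~ i) s) l) <= INR (size s) * C.
Proof.
move=> h; elim: s => [|a s IH].
  by rewrite (eq_count (a2 := pred0)) // count_pred0 /=; lra.
rewrite [size _]/= S_INR.
have : (count (fun i => has (T^~ i) (a :: s)) l
        <= count (T a) l + count (fun i => has (T^~ i) s) l)%N.
  rewrite -count_predUI; exact: leq_addr.
move/leR_nat; rewrite INRD; have := h a; lra.
Qed.

Definition badly_approximable (c theta : R) : Prop :=
  forall (n : nat) (a : Z), (0 < n)%N -> c <= INR n * Rabs (INR n * theta - IZR a).

(** The difference of two such denominators brings [theta] within [2 * eps] of an integer, so bad
    approximability keeps them [1 / (8 * eps)] apart. *)
Lemma count_near_block (theta eps : R) k : badly_approximable (/ 4) theta -> 0 < eps ->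
  INR (count (fun p => ltR (dist_int (INR p * theta)) eps) (iota (2 ^ k) (2 ^ k)))
  <= 16 * 2 ^ k * eps.
Proof.
move=> bad e0; set T := fun p => _.
have K0 : 0 < 2 ^ k by apply: pow_lt; lra.
have eK := INR_pow2 k.
have sep x y : T x -> T y -> (x < y)%N -> / (8 * eps) <= INR y - INR x.
  move=> /ltRP; have [a ->] := dist_int_attained (INR x * theta) => ha.
  move=> /ltRP; have [b ->] := dist_int_attained (INR y * theta) => hb xy.
  have := bad (y - x)%N (b - a)%Z; rewrite subn_gt0 => /(_ xy).
  have -> : INR (y - x)%N = INR y - INR x by rewrite minus_INR //; apply/leP/ltnW.
  rewrite minus_IZR => h.
  have h2 : Rabs ((INR y - INR x) * theta - (IZR b - IZR a)) <= 2 * eps.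
    have -> : (INR y - INR x) * theta - (IZR b - IZR a) =
       (INR y * theta - IZR b) + - (INR x * theta - IZR a) by ring.
    by apply: Rle_trans (Rabs_triang _ _) _; rewrite Rabs_Ropp; lra.
  have := ltR_nat _ _ xy => xy'.
  apply: (Rmult_le_reg_r (8 * eps)); first lra.
  rewrite Rinv_l; [nra|lra].
case: (count_separated T _ (2 ^ k) (2 ^ k) sep) => [->|[z /and3P[/ltRP Tz z1 z2] h]].
  by rewrite [INR 0]/=; nra.
(* Separation gives [1 + 8 * 2 ^ k * eps]. The 1 is absorbed because a single near [z < 2 * 2 ^ k]
   already forces [8 * 2 ^ k * eps > 1]. *)
have z0 : (0 < z)%N by apply: leq_trans z1; rewrite expn_gt0.
move: Tz; have [a ->] := dist_int_attained (INR z * theta) => ha.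
have := bad z a z0; have := ltR_nat _ _ z2; rewrite INRD eK => hz hb.
rewrite eK in h; set c := INR (count _ _) in h *.
have : (c - 1) * / (8 * eps) * (8 * eps) <= 2 ^ k * (8 * eps).
  apply: Rmult_le_compat_r; lra.
rewrite Rmult_assoc Rinv_l; last lra.
have := Rabs_pos (INR z * theta - IZR a); have := pos_INR z; nra.
Qed.

(* A multiple [p * i / 16 ^ (q + d)] of a point of the window is close to at
   most [p / 16 ^ q + 3] integers, and each of them is approached by at most
   [4 * rho * 16 ^ (q + d) / p + 1] of the points. *)
Lemma count_near_window (rho : R) p q d j :
  (16 ^ q <= p)%N -> 0 < rho <= / 4 -> INR p <= rho * 16 ^ (q + d) ->
  INR (count (fun i => ltR (dist_int (INR p * (INR i / 16 ^ (q + d)))) (2 * rho))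
         (iota (j * 16 ^ d) (16 ^ d)))
  <= 20 * rho * 16 ^ d.
Proof.
move=> qp [r0 r4] pr.
have Q0 := pow16_gt0 q; have D0 := pow16_gt0 d.
have Qp : 16 ^ q <= INR p by have := leR_nat _ _ qp; rewrite INRX INR_16.
have M0 := pow16_gt0 (q + d).
have eM : 16 ^ (q + d) = 16 ^ q * 16 ^ d by rewrite pow_add.
set M := 16 ^ (q + d) in eM pr M0 *.
have Q0n : (0 < 16 ^ q)%N by rewrite expn_gt0.
(* These are the candidate integers. The two floors lose less than 1 each and [2 * rho <= 1/2], so 3
   extra values suffice. *)
pose s := iota (j * p %/ 16 ^ q) (p %/ 16 ^ q + 3).
pose T (a i : nat) := ltR (Rabs (INR p * (INR i / M) - INR a)) (2 * rho).
have hsub : (count (fun i => ltR (dist_int (INR p * (INR i / M))) (2 * rho))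
         (iota (j * 16 ^ d) (16 ^ d)) <=
    count (fun i => has (T^~ i) s) (iota (j * 16 ^ d) (16 ^ d)))%N.
  (* The implication holds only for [i] in the window, so it is proved as an equality of filtered
     lists instead of an inclusion of predicates. *)
  rewrite -!size_filter.
  rewrite [X in (size X <= _)%N](_ : _ =
    [seq i <- [seq i <- iota (j * 16 ^ d) (16 ^ d) | has (T^~ i) s] |
       ltR (dist_int (INR p * (INR i / M))) (2 * rho)]).
    by rewrite size_filter; apply: count_size.
  rewrite -filter_predI; apply: eq_in_filter => i /=.
  rewrite mem_iota => /andP[i1 i2].
  have [/ltRP h|//] := boolP (ltR _ _); symmetry.
  move: h; have [a ->] := dist_int_attained (INR p * (INR i / M)) => h.
  have := leR_nat _ _ i1; have := ltR_nat _ _ i2.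
  rewrite INRD !INRM INRX INR_16 => i2' i1'.
  have e1 : INR j * INR p / 16 ^ q = INR p * (INR j * 16 ^ d / M).
    by rewrite eM; field; lra.
  have e2 : INR p / 16 ^ q = INR p * (16 ^ d / M).
    by rewrite eM; field; lra.
  have p0 := pos_INR p.
  have y1 : INR j * INR p / 16 ^ q <= INR p * (INR i / M).
    rewrite e1; apply: Rmult_le_compat_l => //.
    by apply: Rmult_le_compat_r i1'; apply/Rlt_le/Rinv_0_lt_compat.
  have y2 : INR p * (INR i / M) <= INR j * INR p / 16 ^ q + INR p / 16 ^ q.
    rewrite e1 e2 -Rmult_plus_distr_l; apply: Rmult_le_compat_l => //.
    rewrite -Rdiv_plus_distr.
    by apply: Rmult_le_compat_r; [apply/Rlt_le/Rinv_0_lt_compat|lra].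
  have fl n : INR (n %/ 16 ^ q) <= INR n / 16 ^ q < INR (n %/ 16 ^ q) + 1.
    have := leR_nat _ _ (leq_divM n (16 ^ q)).
    have := ltR_nat _ _ (ltn_ceil n Q0n).
    rewrite !INRM S_INR INRX INR_16 => h1 h2; split.
      by apply: (Rmult_le_reg_r (16 ^ q)) => //; rewrite /Rdiv Rmult_assoc Rinv_l; lra.
    by apply: (Rmult_lt_reg_r (16 ^ q)) => //; rewrite /Rdiv Rmult_assoc Rinv_l; lra.
  have f1 := fl (j * p)%N; have f2 := fl p; rewrite INRM in f1.
  have [h1 h2] : -(2*rho) < INR p * (INR i / M) - IZR a < 2 * rho.
    by move: h; rewrite /Rabs; case: Rcase_abs; lra.
  have a0 : (Z.of_nat (j * p %/ 16 ^ q) <= a)%Z.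
    suff : (Z.of_nat (j * p %/ 16 ^ q) < a + 1)%Z by lia.
    by apply: lt_IZR; rewrite plus_IZR -INR_IZR_INZ; lra.
  pose b := Z.to_nat a.
  have eb : Z.of_nat b = a by rewrite /b Z2Nat.id //; lia.
  have eb' : INR b = IZR a by rewrite INR_IZR_INZ eb.
  apply/hasP; exists b; last by apply/ltRP; rewrite eb'.
  rewrite mem_iota; apply/andP; split.
    by apply/leP; lia.
  by apply/ltP; apply: INR_lt; rewrite !INRD eb' [INR 3]/=; lra.
apply: Rle_trans (leR_nat _ _ hsub) _.
have p0 : 0 < INR p by lra.
have each a : INR (count (T a) (iota (j * 16 ^ d) (16 ^ d))) <= 4 * rho * M / INR p + 1.
  apply: count_diam.
    by apply/Rlt_le; apply: Rdiv_lt_0_compat => //; nra.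
  move=> x y /ltRP hx /ltRP hy.
  have : INR p * (INR y / M) - INR p * (INR x / M) <= 4 * rho.
    by move: hx hy; rewrite /Rabs; case: Rcase_abs; case: Rcase_abs; lra.
  have -> : INR p * (INR y / M) - INR p * (INR x / M) = (INR y - INR x) * (INR p / M).
    by field; lra.
  move=> h; have -> : 4 * rho * M / INR p = 4 * rho * / (INR p / M) by field; lra.
  have z0 : 0 < INR p / M by apply: Rdiv_lt_0_compat.
  apply: (Rmult_le_reg_r (INR p / M)) => //.
  by rewrite Rmult_assoc Rinv_l; lra.
apply: Rle_trans (count_has _ _ _ _ _ each) _.
rewrite size_iota INRD [INR 3]/=.
(* Both additive constants are absorbed: 3 by [16 ^ q <= p], then 1 by [p <= rho * M]. The factors 4
   and 5 make up the 20. *)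
have h1 : INR (p %/ 16 ^ q) + (1 + 1 + 1) <= 4 * (INR p / 16 ^ q).
  have := leR_nat _ _ (leq_divM p (16 ^ q)).
  rewrite INRM INRX INR_16 => h.
  apply: (Rmult_le_reg_r (16 ^ q)) => //.
  rewrite Rmult_assoc /Rdiv Rmult_assoc Rinv_l; lra.
have h2 : 4 * rho * M / INR p + 1 <= 5 * rho * M / INR p.
  apply: (Rmult_le_reg_r (INR p)) => //.
  rewrite Rmult_plus_distr_r /Rdiv !Rmult_assoc Rinv_l; nra.
have -> : 20 * rho * 16 ^ d = (4 * (INR p / 16 ^ q)) * (5 * rho * M / INR p).
  by rewrite eM; field; lra.
apply: Rmult_le_compat => //; first by have := pos_INR (p %/ 16 ^ q); lra.
have : 0 < 4 * rho * M / INR p by apply: Rdiv_lt_0_compat => //; nra.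
lra.
Qed.

Lemma count_windows (S : pred nat) W J : (0 < W)%N ->
  count (fun i => S (i %/ W)%N) (iota 0 (J * W)) = (count S (iota 0 J) * W)%N.
Proof.
move=> W0; elim: J => [|J IH]; first by rewrite mul0n.
rewrite mulSn addnC iotaD count_cat IH -addn1 iotaD count_cat mulnDl /= addn0 !add0n.
congr addn; rewrite (eq_in_count (a2 := fun=> S J)).
  by case: (S J); rewrite ?mul1n ?mul0n ?count_predT ?count_pred0 ?size_iota.
move=> i; rewrite mem_iota => /andP[i1 i2].
rewrite (_ : i %/ W = J)%N //; apply/eqP; rewrite eqn_leq leq_divRL // i1 andbT.
by rewrite -ltnS ltn_divLR // mulSn addnC.
Qed.

(** Used with [S] a coarse survivor set: a bound uniform over windows lets later removals be charged
    to the surviving windows alone. *)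
Lemma count_windows_le (S B : pred nat) W J (C : R) : (0 < W)%N ->
  (forall j, INR (count B (iota (j * W) W)) <= C) ->
  INR (count (fun i => S (i %/ W)%N && B i) (iota 0 (J * W)))
  <= INR (count S (iota 0 J)) * C.
Proof.
move=> W0 h; elim: J => [|J IH]; first by rewrite mul0n /=; lra.
rewrite mulSn addnC iotaD count_cat -addn1 iotaD count_cat /= addn0 !add0n !INRD.
rewrite Rmult_plus_distr_r; apply: Rplus_le_compat => //.
rewrite (eq_in_count (a2 := fun i => S J && B i)).
  by case: (S J); rewrite ?count_pred0 /= ?Rmult_1_l; [exact: h|lra].
move=> i; rewrite mem_iota => /andP[i1 i2].
rewrite (_ : i %/ W = J)%N //; apply/eqP; rewrite eqn_leq leq_divRL // i1 andbT.
by rewrite -ltnS ltn_divLR // mulSn addnC.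
Qed.

(** * Survivors in the base-16 tree *)

(** Index [i] at level [L] stands for the interval of length [1 / 16 ^ L] starting at [i / 16 ^ L];
    its parent is [i %/ 16]. Level 0 is never tested. *)
Fixpoint survives (bad : nat -> pred nat) (L i : nat) : bool :=
  if L is L'.+1 then survives bad L' (i %/ 16) && ~~ bad L i else true.

Definition survivors bad L : nat := count (survives bad L) (iota 0 (16 ^ L)).

Lemma survives_ancestor bad q d i :
  survives bad (q + d) i -> survives bad q (i %/ 16 ^ d).
Proof.
elim: d i => [|d IH] i; first by rewrite addn0 divn1.
by rewrite addnS => /andP[/IH + _]; rewrite -divnMA -expnS.
Qed.

(** Each survivor has 16 children, and each child either survives or is removed. *)
Lemma survivorsS bad L :
  (16 * survivors bad L <= survivors bad L.+1 +
    count (fun i => survives bad L (i %/ 16) && bad L.+1 i) (iota 0 (16 ^ L.+1)))%N.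
Proof.
rewrite mulnC -count_windows // -expnSr -count_predUI.
apply: leq_trans (leq_addr _ _); apply: sub_count => i /= ->.
by case: (bad _ _).
Qed.

(* The removals at level [k + 6] are charged to the much coarser level [k / 4].
   As [(L + 1) * density L] has not decreased so far, the density at level
   [k / 4] is at most 24 times the density at level [k + 5]. *)
Lemma survivors_gt0 bad :
  (forall L i, (L < 6)%N -> bad L i = false) ->
  (forall k, INR (count (fun i => survives bad (k + 5) (i %/ 16) && bad (k + 6)%N i)
                   (iota 0 (16 ^ (k + 6)))) / 16 ^ (k + 6)
     <= INR (survivors bad (k %/ 4)) / 16 ^ (k %/ 4) / (168 * (INR k + 1))) ->
  forall L, (0 < survivors bad L)%N.
Proof.
move=> early late.
pose mu L := INR (survivors bad L) / 16 ^ L.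
pose u L := (INR L + 1) * mu L.
have mu0 L : 0 <= mu L.
  apply: Rmult_le_pos; first exact: pos_INR.
  by apply/Rlt_le/Rinv_0_lt_compat/pow16_gt0.
have step L : mu L <= mu L.+1 + INR (count (fun i => survives bad L (i %/ 16) && bad L.+1 i)
    (iota 0 (16 ^ L.+1))) / 16 ^ L.+1.
  have := leR_nat _ _ (survivorsS bad L).
  rewrite INRM INRD INR_16 => h; rewrite /mu; set c := INR (count _ _) in h *.
  have M0 := pow16_gt0 L; have M1 := pow16_gt0 L.+1.
  rewrite -Rdiv_plus_distr.
  have -> : INR (survivors bad L) / 16 ^ L = 16 * INR (survivors bad L) / 16 ^ L.+1.
    by rewrite /=; field; lra.
  by apply: Rmult_le_compat_r => //; apply/Rlt_le/Rinv_0_lt_compat.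
have mono L q : (q <= L)%N -> u q <= u L.
  elim/ltn_ind: L q => -[|L] IH q; first by rewrite leqn0 => /eqP ->; apply: Rle_refl.
  rewrite leq_eqVlt => /orP[/eqP ->|]; first exact: Rle_refl.
  rewrite ltnS => qL; apply: Rle_trans (IH L (ltnSn L) q qL) _.
  have L0 := pos_INR L; have := mu0 L; have := step L.
  rewrite /u S_INR; have [L5|L5] := ltnP L 5.
    rewrite (eq_count (a2 := pred0)) ?count_pred0.
      by rewrite [INR 0]/= /Rdiv Rmult_0_l; nra.
    by move=> i /=; rewrite early ?andbF.
  (* Level [L + 1 = k + 6] is where block [k] is removed. *)
  pose k := (L - 5)%N; have eL : L = (k + 5)%N by rewrite /k subnK.
  have := late k; rewrite -/(mu (k %/ 4)) !addnS addn0.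
  have eL' : k.+4.+1 = L by rewrite eL !addnS addn0.
  rewrite eL'; set c := _ / 16 ^ L.+1 => hc hs m0.
  have k0 := pos_INR k.
  have hq : (k %/ 4 <= L)%N by rewrite eL; apply: leq_trans (leq_div _ _) (leq_addr _ _).
  have := IH L (ltnSn L) _ hq; rewrite /u => hu.
  have hk : INR k + 1 <= 4 * (INR (k %/ 4) + 1).
    have := ltR_nat _ _ (@ltn_ceil k 4 isT).
    have := leR_nat _ _ (@ltn_ceil k 4 isT).
    by rewrite INRM !S_INR [INR 0]/=; lra.
  have ekL : INR L = INR k + 5 by rewrite eL INRD /=; ring.
  (* Here 24 is 4 times 6: [k + 1 <= 4 * (k %/ 4 + 1)], then monotonicity of [u] up to [L = k + 5],
     then [k + 6 <= 6 * (k + 1)]. *)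
  have hm : mu (k %/ 4) <= 24 * mu L.
    have := mu0 (k %/ 4); rewrite ekL in hu.
    have h4 : (INR k + 1) * mu (k %/ 4) <= 4 * ((INR k + 6) * mu L).
      have := mu0 (k %/ 4); nra.
    move=> mq; apply: (Rmult_le_reg_l (INR k + 1)); nra.
  (* As 168 is 24 times 7 and [k + 7 <= 7 * (k + 1)], the loss satisfies [c * (L + 2) <= mu L],
     which is exactly what keeps [u] from decreasing. *)
  have : c * (INR k + 1) <= mu L / 7.
    have : c * (168 * (INR k + 1)) <= mu (k %/ 4).
      apply: Rle_trans (Rmult_le_compat_r (168 * (INR k + 1)) _ _ _ hc) _; first lra.
      rewrite /Rdiv Rmult_assoc Rinv_l; lra.
    lra.
  rewrite ekL => hc'.
  have c0 : c * (INR k + 7) <= mu L.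
    have [cn|cp] := Rle_lt_dec c 0; nra.
  nra.
move=> L; apply/ltP/INR_lt; have := mono L 0%N (leq0n _).
have -> : u 0%N = 1 by rewrite /u /mu /=; field.
rewrite /u /mu => h; apply: Rnot_le_lt => h'.
have h0 : INR (survivors bad L) = 0 by apply: Rle_antisym h' (pos_INR _).
by move: h; rewrite h0 /Rdiv Rmult_0_l Rmult_0_r; lra.
Qed.

(** Compactness: [x] is a cluster point of the left endpoints of the leftmost survivors. The index
    [i] may depend on [e], since [x] can be a common endpoint of two intervals. *)
Lemma survivors_limit bad : (forall L, (0 < survivors bad L)%N) ->
  exists x : R, 0 <= x <= 1 /\
    forall L e, 0 < e -> exists i,
      ~~ bad L.+1 i /\ Rabs (x - INR i / 16 ^ L.+1) <= / 16 ^ L.+1 + e.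
Proof.
move=> pos.
pose c L := find (survives bad L) (iota 0 (16 ^ L)).
have cs L : survives bad L (c L) /\ (c L < 16 ^ L)%N.
  have h : has (survives bad L) (iota 0 (16 ^ L)) by rewrite has_count; apply: pos.
  have h' : (c L < 16 ^ L)%N by rewrite -[X in (_ < X)%N](size_iota 0) -has_find.
  by split => //; have := nth_find 0%N h; rewrite nth_iota.
pose y L := INR (c L) / 16 ^ L.
have y01 L : 0 <= y L <= 1.
  have M0 := pow16_gt0 L; have [_ /ltR_nat] := cs L; rewrite INRX INR_16 => h.
  split; first by apply: Rmult_le_pos (pos_INR _) _; apply/Rlt_le/Rinv_0_lt_compat.
  by apply: (Rmult_le_reg_r (16 ^ L)) => //; rewrite /y /Rdiv Rmult_assoc Rinv_l; lra.
have [x hx] := Bolzano_Weierstrass y (fun t => 0 <= t <= 1) (compact_P3 0 1) y01.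
have near e N : 0 < e -> exists2 L, (N <= L)%N & Rabs (y L - x) < e.
  move=> e0; have [|L [NL h]] := hx (disc x (mkposreal e e0)) N.
    by exists (mkposreal e e0).
  by exists L; [apply/leP|].
exists x; split.
  split; apply: le_epsilon => e e0; have [L _] := near e 0%N e0; have := y01 L;
    rewrite /Rabs; case: Rcase_abs; lra.
move=> L e e0; have [L' LL' hL'] := near e L.+1 e0.
(* The ancestor at level [L + 1] of a deep survivor close to [x]. *)
exists (c L' %/ 16 ^ (L' - L.+1))%N.
have eL' : L' = (L.+1 + (L' - L.+1))%N by rewrite subnKC.
split.
  have : survives bad (L.+1 + (L' - L.+1)) (c L') by rewrite -eL'; case: (cs L').
  by move=> /survives_ancestor/andP[].
move: hL'; rewrite /y; move: (c L') => n; move: (L' - L.+1)%N eL' => d ->.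
rewrite pow_add => h.
have D0 := pow16_gt0 d; have M0 := pow16_gt0 L.+1.
have D0n : (0 < 16 ^ d)%N by rewrite expn_gt0.
have := leR_nat _ _ (leq_divM n (16 ^ d)).
have := ltR_nat _ _ (ltn_ceil n D0n).
rewrite !INRM S_INR INRX INR_16 => h1 h2.
set q := INR (n %/ 16 ^ d) in h1 h2 *; set M := 16 ^ L.+1 in M0 h *.
set D := 16 ^ d in D0 h h1 h2.
have a1 : q / M <= INR n / (M * D).
  have -> : q / M = q * D / (M * D) by field; lra.
  by apply: Rmult_le_compat_r h2; apply/Rlt_le/Rinv_0_lt_compat/Rmult_lt_0_compat.
have a2 : INR n / (M * D) <= q / M + / M.
  have -> : q / M + / M = (q + 1) * D / (M * D) by field; lra.
  by apply: Rmult_le_compat_r; [apply/Rlt_le/Rinv_0_lt_compat/Rmult_lt_0_compat|lra].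
by move: h; rewrite /Rabs; case: Rcase_abs; case: Rcase_abs; lra.
Qed.

(** * The removed neighbourhoods and the Peres-Schlag argument *)

(** Only the left endpoint of an interval is tested; the doubled radius pays for its other points.
    The guard [6 <= L] keeps the truncated [L - 6] from sending low levels to block 0. *)
Definition hits (theta : R) (eps rho : nat -> R) (L i : nat) : bool :=
  (6 <= L)%N &&
  has (fun p => ltR (dist_int (INR p * (INR i / 16 ^ L))) (2 * rho (L - 6)%N))
    [seq p <- iota (2 ^ (L - 6)) (2 ^ (L - 6)) |
       ltR (dist_int (INR p * theta)) (eps (L - 6)%N)].

Lemma mem_block k p :
  (p \in iota (2 ^ k) (2 ^ k)) = (2 ^ k <= p < 2 ^ k.+1)%N.
Proof. by rewrite mem_iota expnS mul2n addnn. Qed.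

(** At most [16 * 2 ^ k * eps k] denominators, each removing at most [20 * rho k * 16 ^ d] points
    per window, give the 320. *)
Lemma count_hits theta eps rho (S : pred nat) k q d :
  badly_approximable (/ 4) theta -> (q + d = k + 6)%N -> (16 ^ q <= 2 ^ k)%N ->
  0 < eps k -> 0 < rho k <= / 4 -> 2 * 2 ^ k <= rho k * 16 ^ (k + 6) ->
  INR (count (fun i => S (i %/ 16 ^ d) && hits theta eps rho (k + 6) i)
         (iota 0 (16 ^ (k + 6))))
  <= INR (count S (iota 0 (16 ^ q))) * (320 * 2 ^ k * (eps k * rho k) * 16 ^ d).
Proof.
move=> bad qd qk e0 r0 res; rewrite -qd expnD.
apply: count_windows_le; first by rewrite expn_gt0.
move=> j; rewrite /hits qd addnK leq_addl /=.
set P := [seq p <- _ | _].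
have D0 := pow16_gt0 d.
(* Membership in [P] is built into [T] so that the bound holds for every [p], as the union bound
   demands. *)
pose T p i := (p \in P) && ltR (dist_int (INR p * (INR i / 16 ^ (k + 6)))) (2 * rho k).
rewrite (eq_count (a2 := fun i => has (T^~ i) P)); last first.
  by move=> i; apply: eq_in_has => p pP; rewrite /T pP.
have each p : INR (count (T p) (iota (j * 16 ^ d) (16 ^ d))) <= 20 * rho k * 16 ^ d.
  rewrite /T; have [|_] := boolP (p \in P); last first.
    by rewrite count_pred0 [INR 0]/=; nra.
  rewrite mem_filter mem_block => /and3P[_ p1 p2]; rewrite /= -qd.
  apply: count_near_window => //; first exact: leq_trans p1.
  have := ltR_nat _ _ p2; rewrite INR_pow2S qd; lra.
apply: Rle_trans (count_has _ _ _ _ _ each) _.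
have := count_near_block theta (eps k) k bad e0; rewrite size_filter => h.
have -> : 320 * 2 ^ k * (eps k * rho k) * 16 ^ d =
  (16 * 2 ^ k * eps k) * (20 * rho k * 16 ^ d) by ring.
apply: Rmult_le_compat_r => //; nra.
Qed.

(** The boolean indexes the two exponent pairs, each allowed half of the loss [1 / (168 * (k + 1))];
    hence 107520 is 320 times 336. *)
Lemma peres_schlag (theta : R) (eps rho : bool -> nat -> R) :
  badly_approximable (/ 4) theta ->
  (forall b k, 0 < eps b k) -> (forall b k, 0 < rho b k <= / 4) ->
  (forall b k, 2 * 2 ^ k <= rho b k * 16 ^ (k + 6)) ->
  (forall b k, 107520 * (eps b k * rho b k) <= / (2 ^ k * (INR k + 1))) ->
  exists x : R, 0 <= x <= 1 /\
    forall b k p, (2 ^ k <= p < 2 ^ k.+1)%N ->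
      dist_int (INR p * theta) < eps b k -> rho b k <= dist_int (INR p * x).
Proof.
move=> ba e0 r0 res small.
pose bad L i := hits theta (eps true) (rho true) L i
                || hits theta (eps false) (rho false) L i.
have [|x [x01 hx]] := survivors_limit bad.
  apply: survivors_gt0 => [L i L6|k]; first by rewrite /bad /hits leqNgt L6.
  (* This [q] gives [16 ^ q <= 2 ^ k], so the windows are no shorter than [1 / 2 ^ k]. *)
  pose q := (k %/ 4)%N; pose d := (k + 6 - q)%N.
  have q4 : (q * 4 <= k)%N by apply: leq_divM.
  have qd : (q + d = k + 6)%N.
    by rewrite /d subnKC //; apply: leq_trans (leq_div _ _) (leq_addr _ _).
  have qk : (16 ^ q <= 2 ^ k)%N by rewrite -(expnM 2 4) leq_exp2l // mulnC.
  pose S := survives bad q.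
  pose F b := count (fun i => S (i %/ 16 ^ d)%N && hits theta (eps b) (rho b) (k + 6) i)
                (iota 0 (16 ^ (k + 6))).
  have h b : INR (F b) <= INR (survivors bad q) * (320 * 2 ^ k * (eps b k * rho b k) * 16 ^ d).
    exact: count_hits.
  have hs : (count (fun i => survives bad (k + 5) (i %/ 16) && bad (k + 6) i)
               (iota 0 (16 ^ (k + 6))) <= F true + F false)%N.
    rewrite -count_predUI; apply: leq_trans (leq_addr _ _).
    apply: sub_count => i /= /andP[si]; rewrite /bad -andb_orr => ->; rewrite andbT.
    have d0 : d = d.-1.+1.
      rewrite prednK // /d subn_gt0; apply: leq_ltn_trans (leq_div _ _) _.
      by rewrite -addn1 leq_add2l.
    rewrite d0 expnS divnMA; apply: survives_ancestor.
    by have -> : (q + d.-1 = k + 5)%N by apply: succn_inj; rewrite -addnS -d0 qd !addnS.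
  have N0 := pos_INR (survivors bad q).
  have K0 : 0 < 2 ^ k by apply: pow_lt; lra.
  have k0 := pos_INR k.
  have D0 := pow16_gt0 d; have Q0 := pow16_gt0 q.
  have h' b : INR (F b) <= INR (survivors bad q) * 16 ^ d / (336 * (INR k + 1)).
    apply: Rle_trans (h b) _.
    have -> : INR (survivors bad q) * 16 ^ d / (336 * (INR k + 1)) =
      INR (survivors bad q) * (320 * 2 ^ k * (/ 107520 * / (2 ^ k * (INR k + 1))) * 16 ^ d).
      by field; lra.
    have := small b k => hsm.
    apply: Rmult_le_compat_l => //; apply: Rmult_le_compat_r; first lra.
    apply: Rmult_le_compat_l; lra.
  have := leR_nat _ _ hs; rewrite INRD => hs'.
  have -> : INR (survivors bad (k %/ 4)) / 16 ^ (k %/ 4) / (168 * (INR k + 1)) =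
    2 * (INR (survivors bad q) * 16 ^ d / (336 * (INR k + 1))) / 16 ^ (k + 6).
    by rewrite -qd pow_add -/q; field; lra.
  apply: Rmult_le_compat_r; first by apply/Rlt_le/Rinv_0_lt_compat/pow16_gt0.
  by have := h' true; have := h' false; lra.
exists x; split => // b k p kp near.
have [a ->] := dist_int_attained (INR p * x).
have p0 : 0 < INR p.
  by apply: (ltR_nat 0); case/andP: kp => + _; apply: leq_trans; rewrite expn_gt0.
apply: le_epsilon => e ep.
(* The tolerance becomes [e] after multiplication by [p]. Moving from the endpoint to [x] then costs
   at most [rho b k + e] of the [2 * rho b k]. *)
have [i [nb hi]] := hx (k + 5)%N (e / INR p) (Rdiv_lt_0_compat _ _ ep p0).
rewrite -addnS in nb hi.
have far : 2 * rho b k <= dist_int (INR p * (INR i / 16 ^ (k + 6))).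
  apply: Rnot_lt_le => close; move/negP: nb; apply.
  have : hits theta (eps b) (rho b) (k + 6) i.
    rewrite /hits addnK leq_addl /=; apply/hasP; exists p; last exact/ltRP.
    by rewrite mem_filter mem_block kp andbT; apply/ltRP.
  by rewrite /bad; case: (b) => ->; rewrite ?orbT.
have M0 := pow16_gt0 (k + 6).
have pM : INR p * / 16 ^ (k + 6) <= rho b k.
  apply: (Rmult_le_reg_r (16 ^ (k + 6))) => //.
  rewrite Rmult_assoc Rinv_l; last lra.
  by case/andP: kp => _ /ltR_nat; rewrite INR_pow2S; have := res b k; lra.
have hp : Rabs (INR p * (INR i / 16 ^ (k + 6)) - INR p * x) <= rho b k + e.
  rewrite -Rmult_minus_distr_l Rabs_mult Rabs_minus_sym Rabs_pos_eq; last lra.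
  have := Rmult_le_compat_l _ _ _ (Rlt_le _ _ p0) hi.
  have -> : INR p * (/ 16 ^ (k + 6) + e / INR p) = INR p * / 16 ^ (k + 6) + e.
    by field; lra.
  lra.
have := dist_int_le (INR p * (INR i / 16 ^ (k + 6))) a.
have := Rabs_triang (INR p * (INR i / 16 ^ (k + 6)) - INR p * x) (INR p * x - IZR a).
have -> : INR p * (INR i / 16 ^ (k + 6)) - INR p * x + (INR p * x - IZR a)
  = INR p * (INR i / 16 ^ (k + 6)) - IZR a by ring.
lra.
Qed.

(** * Real powers and thresholds uniform on dyadic blocks *)

Lemma Rpower_between (x a : R) : 0 < x -> 0 <= a <= 1 ->
  Rmin 1 x <= Rpower x a <= Rmax 1 x.
Proof.
move=> x0 [a0 a1].
have e1 : exp (ln x) = x by apply: exp_ln.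
have le s t : s <= t -> exp s <= exp t.
  by case=> [/exp_increasing/Rlt_le//|->]; apply: Rle_refl.
have [lx|lx] := Rle_lt_dec 0 (ln x).
- split.
    by apply: Rle_trans (Rmin_l _ _) _; rewrite -exp_0; apply: le; nra.
  by apply: Rle_trans _ (Rmax_r _ _); rewrite -{2}e1; apply: le; nra.
- split.
    by apply: Rle_trans (Rmin_r _ _) _; rewrite -{1}e1; apply: le; nra.
  by apply: Rle_trans _ (Rmax_l _ _); rewrite -exp_0; apply: le; nra.
Qed.

Definition weight (k : nat) : R := 2 ^ k * (INR k + 1) / 4.

Lemma weight_ge k : / 4 <= weight k.
Proof.
have : 1 <= 2 ^ k by apply: pow_R1_Rle; lra.
have := pos_INR k; rewrite /weight; nra.
Qed.

(** For [k >= 1], [ln p >= k * ln 2 > k / 2 >= (k + 1) / 4]; block 0 rests on [ln 2 > 1/4]. *)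
Lemma weight_le k p : (2 ^ k <= p)%N -> weight k <= INR p * ln (INR p + 1).
Proof.
move=> /leR_nat; rewrite INR_pow2 => h.
have K1 : 1 <= 2 ^ k by apply: pow_R1_Rle; lra.
have l2 : / 2 < ln 2 by apply: ln_lt_2.
have k0 := pos_INR k.
suff hl : (INR k + 1) / 4 <= ln (INR p + 1).
  rewrite /weight /Rdiv Rmult_assoc; apply: Rmult_le_compat => //; lra.
case: k h K1 k0 => [|k] h K1 k0.
  apply: (Rle_trans _ (ln 2)); first by rewrite [INR 0]/=; lra.
  case: h => [h|<-] /=; last by right; congr ln; ring.
  by apply/Rlt_le/ln_increasing; rewrite /= in h *; lra.
apply: (Rle_trans _ (ln (2 ^ k.+1))).
  by rewrite ln_pow; [rewrite S_INR in k0 *; have := pos_INR k; nra|lra].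
by apply/Rlt_le/ln_increasing; lra.
Qed.

(* The thresholds of a whole block are those of the lower bound [weight k] for
   [p * ln (p + 1)], which makes them uniform in [p]. *)
Lemma BADstar_of_blocks (a b d x1 x2 : R) :
  0 <= a -> 0 <= b -> 0 <= d -> unit_int x1 -> unit_int x2 ->
  (forall k p, (2 ^ k <= p < 2 ^ k.+1)%N ->
     dist_int (INR p * x2) < d / Rpower (weight k) b ->
     d / Rpower (weight k) a <= dist_int (INR p * x1)) ->
  BADstar a b d x1 x2.
Proof.
move=> a0 b0 d0 ux1 ux2 h; do 2!split => //; move=> p /leP p1.
have kp := trunc_log_bounds (isT : 1 < 2)%N p1.
set k := trunc_log 2 p in kp.
have w0 : 0 < weight k by have := weight_ge k; lra.
have wp : weight k <= INR p * ln (INR p + 1) by apply: weight_le; case/andP: kp.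
have scale c t : 0 <= c -> d / Rpower (weight k) c <= t ->
    d <= Rpower (INR p * ln (INR p + 1)) c * t.
  move=> c0 ht; have W0 : 0 < Rpower (weight k) c by apply: exp_pos.
  have Wp : Rpower (weight k) c <= Rpower (INR p * ln (INR p + 1)) c.
    by apply: Rle_Rpower_l.
  have t0 : 0 <= t.
    by apply: Rle_trans ht; apply: Rmult_le_pos d0 _; apply/Rlt_le/Rinv_0_lt_compat.
  have -> : d = Rpower (weight k) c * (d / Rpower (weight k) c) by field; lra.
  apply: Rmult_le_compat => //; first lra.
  by apply: Rmult_le_pos d0 _; apply/Rlt_le/Rinv_0_lt_compat.
have [far|near] := Rle_lt_dec (d / Rpower (weight k) b) (dist_int (INR p * x2)).
- by apply: Rle_trans (Rmax_r _ _); apply: scale.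
- by apply: Rle_trans (Rmax_l _ _); apply: scale => //; apply: h near.
Qed.

(** * Choice of the point and of the thresholds *)

Theorem theorem1 (a1 b1 a2 b2 d : R) :
  0 <= a1 <= 1 -> 0 <= b1 <= 1 -> 0 <= a2 <= 1 -> 0 <= b2 <= 1 ->
  a1 + b1 = 1 -> a2 + b2 = 1 ->
  0 < d -> d <= Rpower 2 (-20) ->
  exists x1 x2 : R,
    BAD 0 1 d x1 x2 /\ BADstar a1 b1 d x1 x2 /\ BADstar a2 b2 d x1 x2.
Proof.
move=> ha1 hb1 ha2 hb2 s1 s2 d0 dle.
set D := Rpower 2 (-20) in dle.
have eD : D = / 2 ^ 20.
  rewrite /D (_ : -20 = - INR 20); last by rewrite /=; ring.
  by rewrite Rpower_Ropp Rpower_pow //; lra.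
have D0 : 0 < D by lra.
have Dle : D <= / 1048576 by rewrite eD; lra.
have sq := sqrt_sqrt 2; have sq0 := sqrt_pos 2.
set theta := sqrt 2 - 1.
have theta01 : 0 <= theta <= 1 by rewrite /theta; split; nra.
have ba : badly_approximable (/ 4) theta by move=> n z; apply: sqrt2_badly_approximable.
pose al (s : bool) := if s then a1 else a2.
pose be (s : bool) := if s then b1 else b2.
have hal s : 0 <= al s <= 1 by case: s.
have hbe s : 0 <= be s <= 1 by case: s.
have hs s : al s + be s = 1 by case: s.
have w4 k := weight_ge k.
have P0 c k : 0 < Rpower (weight k) c by apply: exp_pos.
have Pb c k : 0 <= c <= 1 -> / 4 <= Rpower (weight k) c <= 2 ^ k * (INR k + 1).
  move=> hc; have [] := Rpower_between (weight k) c _ hc; first by have := w4 k; lra.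
  have h1 : 1 <= 2 ^ k by apply: pow_R1_Rle; lra.
  have k0 := pos_INR k; have := w4 k.
  have h2 : 1 <= 2 ^ k * (INR k + 1) by nra.
  have h3 : weight k <= 2 ^ k * (INR k + 1) by rewrite /weight; lra.
  by rewrite /Rmin /Rmax; case: Rle_dec => _; lra.
(* The thresholds use [D] instead of [d]: a very small [d] would violate the resolution condition,
   and the conclusion for [D] implies the one for [d <= D]. *)
have [||||x [x01 hx]] := @peres_schlag theta
    (fun s k => D / Rpower (weight k) (be s)) (fun s k => D / Rpower (weight k) (al s)) ba.
- by move=> s k; apply: Rdiv_lt_0_compat.
- move=> s k; split; first exact: Rdiv_lt_0_compat.
  have [h _] := Pb _ k (hal s).
  apply: (Rmult_le_reg_r (Rpower (weight k) (al s))) => //.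
  rewrite /Rdiv Rmult_assoc Rinv_l; lra.
- move=> s k; have [_ h] := Pb _ k (hal s).
  have W0 := P0 (al s) k.
  have K0 : 0 < 2 ^ k by apply: pow_lt; lra.
  have kK : INR k + 1 <= 2 ^ k by rewrite -S_INR -INR_pow2; apply/leR_nat/ltn_expl.
  (* The 6 extra levels contribute [2 ^ 24], which outweighs [D] and leaves 16. *)
  have e16 : D * 16 ^ (k + 6) = 16 * 2 ^ k * 2 ^ k * 2 ^ k * 2 ^ k.
    rewrite pow_add eD (_ : 16 = 2 * 2 * 2 * 2); last ring.
    by rewrite !Rpow_mult_distr; field.
  apply: (Rmult_le_reg_r (Rpower (weight k) (al s))) => //.
  have -> : D / Rpower (weight k) (al s) * 16 ^ (k + 6) * Rpower (weight k) (al s)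
     = D * 16 ^ (k + 6) by field; lra.
  rewrite e16.
  have K1 : 1 <= 2 ^ k by apply: pow_R1_Rle; lra.
  have h2 : Rpower (weight k) (al s) <= 2 ^ k * 2 ^ k by nra.
  have h3 : 0 < 2 ^ k * 2 ^ k by nra.
  have h4 : 2 * 2 ^ k * Rpower (weight k) (al s) <= 2 * 2 ^ k * (2 ^ k * 2 ^ k) by nra.
  nra.
- move=> s k.
  (* Since the exponents sum to 1, the product of the thresholds no longer depends on them. *)
  have -> : D / Rpower (weight k) (be s) * (D / Rpower (weight k) (al s)) = D * D / weight k.
    rewrite -{3}(Rpower_1 (weight k)); last by have := w4 k; lra.
    rewrite -(hs s) Rpower_plus; field; split; apply: Rgt_not_eq; exact: P0.
  have K0 : 0 < 2 ^ k by apply: pow_lt; lra.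
  have k0 := pos_INR k.
  have -> : 107520 * (D * D / weight k) = (430080 * (D * D)) * / (2 ^ k * (INR k + 1)).
    by rewrite /weight; field; lra.
  rewrite -[X in _ <= X]Rmult_1_l; apply: Rmult_le_compat_r; last nra.
  by apply/Rlt_le/Rinv_0_lt_compat; nra.
have star s : BADstar (al s) (be s) d x theta.
  apply: BADstar_of_blocks => //; [by case: (hal s)|by case: (hbe s)|lra|].
  move=> k p kp near; apply: Rle_trans (hx s k p kp _).
    by apply: Rmult_le_compat_r dle; apply/Rlt_le/Rinv_0_lt_compat.
  apply: Rlt_le_trans near _.
  by apply: Rmult_le_compat_r dle; apply/Rlt_le/Rinv_0_lt_compat.
exists x, theta; split; last by split; [apply: (star true)|apply: (star false)].
do 2!split => //; move=> p /leP p1.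
(* The second coordinate alone suffices: [p] times its distance is at least 1/4, which exceeds
   [d]. *)
apply: Rle_trans (Rmax_r _ _).
rewrite Rpower_1; last by apply: (ltR_nat 0).
have [z ->] := dist_int_attained (INR p * theta).
by have := ba p z p1; lra.
Qed.
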